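(* For each integer $t\ge 0$ we have $n_2(5,9+16t,2)=20+31t$, $n_2(5,10+16t,2)=21+31t$, $n_2(5,11+16t,2)=23+31t$, $n_2(5,12+16t,2)=24+31t$, $n_2(5,13+16t,2)=27+31t$, $n_2(5,14+16t,2)=28+31t$, $n_2(5,15+16t,2)=30+31t$, $n_2(5,16+16t,2)=31+31t$, $n_2(5,17+16t,2)=36+31t$, $n_2(5,18+16t,2)=37+31t$, $n_2(5,19+16t,2)=39+31t$, $n_2(5,20+16t,2)=40+31t$, $n_2(5,21+16t,2)=43+31t$, $n_2(5,22+16t,2)=44+31t$, $n_2(5,23+16t,2)=46+31t$, and $n_2(5,24+16t,2)=47+31t$. Moreover, $n_2(5,1,2)=n_2(5,2,2)=8$, $n_2(5,3,2)=10$, $n_2(5,4,2)=11$, $n_2(5,5,2)=13$, $n_2(5,6,2)=14$, $n_2(5,7,2)=16$, and $n_2(5,8,2)=17$.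
   Context: An $[n,k,d]_q$-code is a $k$-dimensional subspace of $\mathbb{F}_q^n$ with minimum Hamming distance at least $d$. A linear code $C\subseteq\mathbb{F}_q^n$ has locality $r$ if for every coordinate $i$ there is a set $S_i\subseteq\{1,\dots,n\}\setminus\{i\}$ with $|S_i|\le r$ such that any two codewords agreeing on all coordinates in $S_i$ also agree in coordinate $i$. $n_q(k,d,r)$ denotes the minimum length $n$ of an $[n,k,d]_q$-code with locality $r$. *)

(* Defs.v *)
From HB Require Import structures.
From mathcomp Require Import all_boot all_order all_algebra.

Set Implicit Arguments.
Unset Strict Implicit.
Unset Printing Implicit Defensive.

Import GRing.Theory.

Definition hamming_dist (F : finFieldType) (n : nat) (x y : 'rV[F]_n) : nat :=
  #|[set i : 'I_n | x ord0 i != y ord0 i]|.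

Definition min_dist_ge (F : finFieldType) (n : nat) (C : {vspace 'rV[F]_n})
    (d : nat) : Prop :=
  forall x y : 'rV[F]_n, x \in C -> y \in C -> x != y -> d <= hamming_dist x y.

Definition is_code (F : finFieldType) (n k d : nat) (C : {vspace 'rV[F]_n}) :
    Prop :=
  \dim C = k /\ min_dist_ge C d.

Definition has_locality (F : finFieldType) (n : nat) (C : {vspace 'rV[F]_n})
    (r : nat) : Prop :=
  forall i : 'I_n, exists S : {set 'I_n},
    [/\ i \notin S, #|S| <= r &
        forall x y : 'rV[F]_n, x \in C -> y \in C ->
          (forall j, j \in S -> x ord0 j = y ord0 j) -> x ord0 i = y ord0 i].

Definition is_lrc_length (F : finFieldType) (k d r n : nat) : Prop :=
  exists C : {vspace 'rV[F]_n}, is_code k d C /\ has_locality C r.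

(* n_q(k,d,r) = n, where q = #|F|; a relation rather than a function, so that
   it also asserts that the minimum exists. *)
Definition min_lrc_length (F : finFieldType) (k d r n : nat) : Prop :=
  is_lrc_length F k d r n /\
  forall m : nat, is_lrc_length F k d r m -> n <= m.

(* Main.v *)
(* Lower bounds. For d >= 9 this is the Griesmer bound. For smaller d, locality 2
   gives every coordinate i a dual codeword of weight at most 3 whose support L
   contains i. Shortening the code on L loses |L| coordinates but at most |L| - 1
   dimensions, so dim + (number of shortened coordinates) grows with every new
   L; one such step followed by the Griesmer bound settles d = 5, ..., 8, and
   three steps settle d <= 2. If d is 3 or 4 and n <= d + 6, the supports are
   triples, pairwise disjoint when distinct; a word vanishing on two of them
   then has to be 1 everywhere else, hence has odd weight on a third one.

   Upper bounds. The columns of a generator matrix form a multiset of points of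
   F_2^5, given explicitly; adding t copies of all 31 nonzero points adds 16 t to
   the minimum distance and keeps the locality. *)
Require Import Defs.
From HB Require Import structures.
From mathcomp Require Import all_boot all_order all_algebra.
From mathcomp Require Import zify.

Set Implicit Arguments.
Unset Strict Implicit.
Unset Printing Implicit Defensive.

Import GRing.Theory.
Local Open Scope ring_scope.

(** * Arithmetic in the field with two elements, and the Griesmer sum *)

Lemma F2_neq0 (x : 'F_2) : (x != 0) = (x == 1).
Proof. by case: x => [[|[|//]] ?]. Qed.

Lemma F2_boolE (x : 'F_2) : x = (x != 0)%:R.
Proof. by apply/eqP; case: x => [[|[|//]] ?]. Qed.

Lemma F2_subr_neq0 (x y : 'F_2) : (x - y != 0) = (x != 0) (+) (y != 0).
Proof. by case: x => [[|[|//]] ?]; case: y => [[|[|//]] ?]. Qed.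

Lemma F2_addrr (x : 'F_2) : x + x = 0.
Proof. by apply/eqP; case: x => [[|[|//]] ?]. Qed.

(* Since ceil(d / 2^i) is the i-fold iterate of ceil(- / 2), this is the sum of
   ceil(d / 2^i) over i < k. *)
Fixpoint griesmer (k d : nat) : nat :=
  if k is k'.+1 then (d + griesmer k' (uphalf d))%N else 0%N.

Lemma leq_griesmer k1 k2 d1 d2 :
  (k1 <= k2)%N -> (d1 <= d2)%N -> (griesmer k1 d1 <= griesmer k2 d2)%N.
Proof.
elim: k1 k2 d1 d2 => [|k1 IHk] [|k2] //= d1 d2 lek led.
by apply: leq_add => //; apply: IHk => //; apply: uphalf_leq.
Qed.

Lemma griesmer_ge k d : (0 < d)%N -> (k <= griesmer k d)%N.
Proof.
by elim: k d => //= k IHk d d0; have := IHk (uphalf d); lia.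
Qed.

(** * Binary words, their supports, and the Griesmer bound *)

Section BinaryCodes.

Variable n : nat.
Implicit Types (x y c : 'rV['F_2]_n) (C : {vspace 'rV['F_2]_n}).
Implicit Types T U L : {set 'I_n}.

Definition supp x : {set 'I_n} := [set i | x 0 i != 0].
Definition wt x : nat := #|supp x|.

Definition min_wt_ge C d := forall x, x \in C -> x != 0 -> (d <= wt x)%N.

Lemma hamming_dist_wt x y : hamming_dist x y = wt (x - y).
Proof.
by apply: eq_card => i; rewrite !inE !mxE subr_eq0.
Qed.

Lemma min_dist_ge_wt C d : min_dist_ge C d <-> min_wt_ge C d.
Proof.
split=> [dC x Cx x0 | dC x y Cx Cy xy].
  by have := dC x 0 Cx (mem0v _) x0; rewrite hamming_dist_wt subr0.
by rewrite hamming_dist_wt dC ?rpredB // subr_eq0.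
Qed.

Lemma supp_eq0 x : (supp x == set0) = (x == 0).
Proof.
apply/eqP/eqP => [s0|->]; last by apply/setP=> i; rewrite !inE mxE eqxx.
apply/rowP=> i; rewrite mxE; apply/eqP/negbFE.
by have := in_set0 i; rewrite -s0 inE.
Qed.

Lemma wt0 : wt 0 = 0%N.
Proof. by apply/eqP; rewrite /wt cards_eq0 supp_eq0. Qed.

(** Projection onto the coordinates in [T], kept inside the full space: on a code its kernel is a
    shortening and its image a puncturing padded with zeros. *)
Definition mask T : 'End('rV['F_2]_n) :=
  linfun (mulmxr (diag_mx (\row_j (j \in T)%:R))).

Lemma maskE T x j : mask T x 0 j = if j \in T then x 0 j else 0.
Proof.
by rewrite lfunE /= mul_mx_diag !mxE; case: (j \in T); rewrite ?mulr1 ?mulr0.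
Qed.

Lemma supp_mask T x : supp (mask T x) = supp x :&: T.
Proof.
by apply/setP=> j; rewrite !inE maskE; case: (j \in T); rewrite ?andbT ?andbF ?eqxx.
Qed.

(** Outside [supp c] the words [x] and [x - c] agree; on [supp c] exactly one of them is nonzero at
    each position. *)
Lemma wt_residual x c :
  (wt x + wt (x - c) = (wt (mask (~: supp c) x)).*2 + wt c)%N.
Proof.
rewrite /wt supp_mask -setDE -(cardsID (supp c) (supp x)).
rewrite -(cardsID (supp c) (supp (x - c))).
have -> : supp (x - c) :\: supp c = supp x :\: supp c.
  apply/setP=> i; rewrite !inE !mxE F2_subr_neq0.
  by case: (c 0 i == 0); rewrite ?andbF //= addbF.
have -> : supp (x - c) :&: supp c = supp c :\: supp x.
  apply/setP=> i; rewrite !inE !mxE F2_subr_neq0.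
  by case: (c 0 i == 0); case: (x 0 i == 0).
have := cardsID (supp x) (supp c); rewrite setIC; lia.
Qed.

Lemma wt_residual_ge x c :
  (wt c <= wt x)%N -> (wt c <= wt (x - c))%N ->
  (uphalf (wt c) <= wt (mask (~: supp c) x))%N.
Proof. by move=> cx cxc; have := wt_residual x c; lia. Qed.

(* The residual code with respect to a word c of minimum weight has dimension
   one less, and minimum weight at least half that of c. *)
Lemma griesmer_bound C T d :
  min_wt_ge C d -> (forall x, x \in C -> supp x \subset T) ->
  (griesmer (\dim C) d <= #|T|)%N.
Proof.
have [k dimC] : {k | \dim C = k} by exists (\dim C).
rewrite dimC; elim: k C T d dimC => [//|k IHk] C T d dimC dC CT /=.
have [c [Cc c0 minc]] : exists c, [/\ c \in C, c != 0 &
    forall x, x \in C -> x != 0 -> (wt c <= wt x)%N].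
  have Cx0 : (vpick C \in C) && (vpick C != 0).
    by rewrite memv_pick vpick0 -dimv_eq0 dimC.
  case: (arg_minnP (P := fun x => (x \in C) && (x != 0)) wt Cx0) => c.
  move=> /andP[Cc c0] minc; exists c; split=> // x Cx x0.
  by apply: minc; rewrite Cx.
set m := mask (~: supp c).
(* A word of [C] other than 0 and [c] that vanishes outside [supp c] would satisfy
   [wt x + wt (x - c) = wt c], with both terms at least [wt c > 0]. *)
have kerP x : x \in C -> (m x == 0) = (x == 0) || (x == c).
  move=> Cx; apply/idP/idP => [mx0|/orP[]/eqP->]; last first.
  - by rewrite -supp_eq0 supp_mask setICr.
  - by rewrite linear0.
  apply/negPn/negP; rewrite negb_or => /andP[x0 xc].
  have := wt_residual x c; rewrite -/m (eqP mx0) wt0.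
  have := minc _ Cx x0; have := minc (x - c); rewrite rpredB // subr_eq0.
  move/(_ isT xc); have := c0; rewrite -supp_eq0 -cards_eq0 -/(wt c); lia.
have dimm : \dim (m @: C) = k.
  have := limg_ker_dim m C; rewrite dimC.
  suff -> : (C :&: lker m)%VS = <[c]>%VS by rewrite dim_vline c0 add1n => -[].
  apply/vspaceP=> x; rewrite memv_cap memv_ker.
  apply/andP/vlineP => [[Cx]|[a ->]].
    rewrite kerP // => /orP[]/eqP->; first by exists 0; rewrite scale0r.
    by exists 1; rewrite scale1r.
  rewrite rpredZ // kerP ?rpredZ //; split=> //.
  have [->|] := eqVneq a 0; first by rewrite scale0r eqxx.
  by rewrite F2_neq0 => /eqP->; rewrite scale1r eqxx orbT.
have lew : (d <= wt c)%N by apply: dC.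
(* [d] is first raised to the true minimum weight [wt c], which is also the number of coordinates
   split off from [T]. *)
apply: (@leq_trans (wt c + griesmer k (uphalf (wt c)))).
  by apply: leq_add => //; apply: leq_griesmer => //; apply: uphalf_leq.
rewrite -(cardsID (supp c) T) setIC; move/setIidPl: (CT c Cc) => ->.
rewrite leq_add2l; apply: (IHk (m @: C)%VS) => // y /memv_imgP[x Cx ->].
  rewrite kerP // negb_or => /andP[x0 xc].
  by apply: wt_residual_ge; apply: minc; rewrite ?rpredB // subr_eq0.
by rewrite supp_mask -setDE setSD // CT.
Qed.

(** * Shortened codes and local parity checks *)

Definition short C U : {vspace 'rV['F_2]_n} := (C :&: lker (mask U))%VS.

Lemma mem_short C U x :
  (x \in short C U) = (x \in C) && [disjoint supp x & U].
Proof. by rewrite memv_cap memv_ker -supp_eq0 supp_mask -setI_eq0. Qed.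

Lemma shortP C U x :
  reflect (x \in C /\ forall j, j \in U -> x 0 j = 0) (x \in short C U).
Proof.
rewrite mem_short; apply: (iffP andP) => -[Cx xU]; split=> //.
  by move=> j jU; have := disjointFl xU jU; rewrite inE => /negbFE/eqP.
rewrite disjoint_sym disjoints_subset; apply/subsetP=> j jU.
by rewrite !inE xU ?eqxx.
Qed.

Lemma short0 C : short C set0 = C.
Proof.
by apply/vspaceP=> x; rewrite mem_short disjoint_sym disjoints_subset sub0set andbT.
Qed.

(** Rank-nullity for the projection onto coordinate [j], whose image lies in a line. *)
Lemma dim_short_setU1 C U j : (\dim (short C U) <= (\dim (short C (j |: U))).+1)%N.
Proof.
have kerE : (short C U :&: lker (mask [set j]) <= short C (j |: U))%VS.
  apply/subvP=> x /memv_capP[/shortP[Cx xU]]; rewrite memv_ker => /eqP xj.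
  apply/shortP; split=> // k; rewrite !inE => /orP[/eqP->|/xU//].
  by have := maskE [set j] x j; rewrite xj inE eqxx mxE.
pose e : 'rV['F_2]_n := delta_mx 0 j.
have imgE : (mask [set j] @: short C U <= <[e]>)%VS.
  apply/subvP=> y /memv_imgP[x _ ->]; apply/vlineP.
  exists (x 0 j); apply/rowP=> i; rewrite maskE !mxE eqxx inE.
  by case: eqVneq => [->|]; rewrite ?mulr1 ?mulr0.
rewrite -(limg_ker_dim (mask [set j]) (short C U)).
apply: leq_trans (leq_add (dimvS kerE) (dimvS imgE)) _.
by rewrite dim_vline -[X in (_ <= X)%N]addn1 leq_add2l leq_b1.
Qed.

(** Each new coordinate costs at most one dimension, so the potential, dimension plus number of
    shortened coordinates, never decreases. *)
Lemma dim_short_setU C U T :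
  (\dim (short C U) + #|U| <= \dim (short C (U :|: T)) + #|U :|: T|)%N.
Proof.
have [k Tk] : {k | #|T :\: U| = k} by exists #|T :\: U|.
elim: k U Tk => [|k IHk] U Tk.
  by move/eqP: Tk; rewrite cards_eq0 setD_eq0 => /setUidPl->.
have /set0Pn[j] : T :\: U != set0 by rewrite -cards_eq0 Tk.
rewrite inE => /andP[jU jT].
have -> : U :|: T = (j |: U) :|: T.
  by apply/setP=> i; rewrite !inE; case: eqVneq => //= ->; rewrite jT orbT.
apply: leq_trans (IHk _ _); last first.
  rewrite setUC -setDDl; have := cardsD1 j (T :\: U).
  by rewrite Tk !inE jU jT => -[].
by have := dim_short_setU1 C U j; rewrite cardsU1 jU; lia.
Qed.

Definition parity_check C L := forall x, x \in C -> \sum_(j in L) x 0 j = 0.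

(** Pick [i] in [L] outside [U]. Vanishing on [U] and on the rest of [L] forces vanishing at [i], so
    [i] enlarges the set at no cost in dimension. *)
Lemma dim_short_parity_check C U L :
  parity_check C L -> ~~ (L \subset U) ->
  (\dim (short C U) + #|U| < \dim (short C (U :|: L)) + #|U :|: L|)%N.
Proof.
move=> pL /subsetPn[i iL iU].
have := dim_short_setU C U (L :\ i).
have -> : short C (U :|: L :\ i) = short C (U :|: L).
  apply/vspaceP=> x; apply/shortP/shortP => -[Cx x0]; split=> // j; last first.
    by move=> jU; apply: x0; move: jU; rewrite !inE => /orP[->|/andP[_ ->]] //;
       rewrite orbT.
  have x0' k : k \in L -> k != i -> x 0 k = 0.
    by move=> kL ki; rewrite x0 // !inE ki kL orbT.
  have [-> _|ji jU] := eqVneq j i.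
    have := pL x Cx; rewrite (bigD1 i) //= big1 ?addr0 // => k /andP[].
    exact: x0'.
  by apply: x0; move: jU; rewrite !inE ji.
have : #|U :|: L| = #|U :|: L :\ i|.+1; last by lia.
rewrite (cardsD1 i (U :|: L)) !inE iL orbT add1n; congr (#|pred_of_set _|.+1).
apply/setP=> j; rewrite !inE; case: eqVneq => [->|] //=.
by rewrite (negPf iU).
Qed.

(** Induction on [S]: shortening at a point [a] of [S] leaves [S :\ a]. Coefficients are 0 or 1, so
    a linear combination is a sum over a subset. *)
Lemma determined_sum C (S : {set 'I_n}) i :
  (forall x, x \in C -> (forall j, j \in S -> x 0 j = 0) -> x 0 i = 0) ->
  exists2 T : {set 'I_n}, T \subset S &
    forall x, x \in C -> x 0 i = \sum_(j in T) x 0 j.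
Proof.
have [k Sk] : {k | #|S| = k} by exists #|S|.
elim: k S C Sk => [|k IHk] S C Sk detS.
  have S0 : S = set0 by apply/eqP; rewrite -cards_eq0 Sk.
  exists set0; rewrite ?sub0set // => x Cx; rewrite big_set0.
  by apply: detS => // j; rewrite S0 inE.
have /set0Pn[a aS] : S != set0 by rewrite -cards_eq0 Sk.
have := cardsD1 a S; rewrite aS Sk => -[/esym Sk'].
have [|T TS sumT] := IHk (S :\ a) (short C [set a]) Sk'.
  move=> x /shortP[Cx xa] xS; apply: detS => // j jS.
  have [->|ja] := eqVneq j a; first by rewrite xa ?inE.
  by rewrite xS // !inE ja.
have aT : a \notin T by apply: contraTN TS => aT; apply/subsetPn; exists a; rewrite // !inE eqxx.
(* If every word vanishes at [a], shortening there loses nothing; otherwise one word [y] with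
   [y 0 a = 1] fixes the coefficient [e] of that coordinate. *)
have [y /andP[Cy ya]|C0] := pickP [pred y | (y \in C) && (y 0 a != 0)]; last first.
  exists T; first exact: subset_trans TS (subD1set _ _).
  move=> x Cx; apply: sumT; apply/shortP; split=> // j /set1P->.
  by have := C0 x; rewrite /= Cx => /negbFE/eqP.
pose e := y 0 i - \sum_(j in T) y 0 j.
have sume x : x \in C -> x 0 i = e * x 0 a + \sum_(j in T) x 0 j.
  move=> Cx; have [xa|xa] := eqVneq (x 0 a) 0.
    rewrite xa mulr0 add0r; apply: sumT; apply/shortP.
    by split=> // j /set1P->.
  have xy : x - y \in short C [set a].
    apply/shortP; split; first exact: rpredB.
    move=> j /set1P->; rewrite !mxE; apply/eqP/negPn; rewrite F2_subr_neq0.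
    by rewrite xa ya.
  have := sumT _ xy; rewrite !mxE.
  under eq_bigr do rewrite !mxE.
  rewrite sumrB => /eqP; rewrite subr_eq => /eqP->.
  move: xa; rewrite F2_neq0 => /eqP->; rewrite /e mulr1.
  by rewrite [LHS]addrC addrA addrAC.
have [e0|] := eqVneq e 0.
  exists T; first exact: subset_trans TS (subD1set _ _).
  by move=> x Cx; rewrite sume // e0 mul0r add0r.
rewrite F2_neq0 => /eqP e1; exists (a |: T).
  by rewrite subUset sub1set aS (subset_trans TS (subD1set _ _)).
by move=> x Cx; rewrite sume // e1 mul1r big_setU1.
Qed.

(** Comparing with the zero word makes coordinate [i] a sum over a subset of its recovery set; in
    characteristic 2 this is a check once [i] joins the subset. *)
Lemma locality_parity_check C r i :
  has_locality C r ->
  exists L, [/\ i \in L, (#|L| <= r.+1)%N & parity_check C L].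
Proof.
move=> /(_ i)[S [iS leS detS]].
have [|T TS sumT] := @determined_sum C S i.
  move=> x Cx xS; rewrite (detS x 0) ?mxE ?mem0v // => j jS.
  by rewrite xS // mxE.
have iT : i \notin T by apply: contra iS; apply: (subsetP TS).
exists (i |: T); split; first by rewrite setU11.
  by rewrite cardsU1 iT add1n ltnS (leq_trans (subset_leq_card TS)).
by move=> x Cx; rewrite big_setU1 //= -sumT // F2_addrr.
Qed.

Lemma griesmer_short C U d :
  min_wt_ge C d -> (griesmer (\dim (short C U)) d + #|U| <= n)%N.
Proof.
move=> dC.
have gU : (griesmer (\dim (short C U)) d <= #|~: U|)%N.
  apply: griesmer_bound => x; rewrite mem_short => /andP[Cx xU].
    exact: dC.
  by rewrite -disjoints_subset.
by have := cardsC U; rewrite card_ord; lia.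
Qed.

Lemma short_neq0 C U :
  (0 < \dim (short C U))%N -> exists x i, [/\ x \in short C U, i \notin U & x 0 i != 0].
Proof.
rewrite lt0n dimv_eq0 -vpick0 -supp_eq0 => /set0Pn[i]; rewrite inE => xi.
exists (vpick (short C U)), i; split=> //; first exact: memv_pick.
by apply: contra xi => iU; have /shortP[_ ->] := memv_pick (short C U).
Qed.

(** A nonzero word of the shortened code is nonzero at some [i] outside [U], and the check through
    [i] is not contained in [U]. *)
Lemma short_locality C U r :
  has_locality C r -> (0 < \dim (short C U))%N ->
  exists L, [/\ (#|L| <= r.+1)%N, parity_check C L, ~~ (L \subset U) &
   (\dim (short C U) + #|U| < \dim (short C (U :|: L)) + #|U :|: L|)%N].
Proof.
move=> locC /short_neq0[x [i [_ iU _]]].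
have [L [iL leL pL]] := locality_parity_check i locC.
have LU : ~~ (L \subset U) by apply/subsetPn; exists i.
by exists L; split=> //; apply: dim_short_parity_check.
Qed.

End BinaryCodes.

(** * Lower bounds on the length for dimension 5 and locality 2 *)

Section Length.

Variables (n d : nat) (C : {vspace 'rV['F_2]_n}).
Hypotheses (dimC : \dim C = 5%N) (dC : min_wt_ge C d) (locC : has_locality C 2).

(** Here [k] is any lower bound for the potential. If [U] has more than [k] elements, the truncated
    difference is 0 and the claim is [#|U| <= n]. *)
Lemma short_length k U : (k <= \dim (short C U) + #|U|)%N ->
  (griesmer (k - #|U|) d + #|U| <= n)%N.
Proof.
move=> kU; apply: leq_trans (griesmer_short U dC); rewrite leq_add2r.
by apply: leq_griesmer; rewrite // leq_subLR addnC.
Qed.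

(** The potential of the empty set is 5, and one check lifts it to at least 6. *)
Lemma length_parity_check1 :
  exists2 u, (0 < u <= 3)%N & (griesmer (6 - u) d + u <= n)%N.
Proof.
have [|L [leL _ L0]] := @short_locality _ C set0 _ locC; first by rewrite short0 dimC.
rewrite short0 dimC cards0 set0U => dL.
exists #|L|; last exact: short_length.
by rewrite leL andbT card_gt0; move: L0; rewrite subset0.
Qed.

Lemma length_dim5 : (griesmer 5 d <= n)%N.
Proof.
by have := griesmer_short set0 dC; rewrite short0 dimC cards0 addn0.
Qed.

(** Three checks lift the potential from 5 to 8. Two of them cover at most 6 coordinates at
    potential at least 7, so a nonzero word remains for the third. *)
Lemma length_ge8 : (0 < d)%N -> (8 <= n)%N.
Proof.
move=> d0.
have gU k U : (k <= \dim (short C U) + #|U|)%N -> (k <= n)%N.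
  by move=> /short_length; have := griesmer_ge (k - #|U|) d0; lia.
have [|L1 [leL1 _ _]] := @short_locality _ C set0 _ locC; first by rewrite short0 dimC.
rewrite short0 dimC cards0 set0U => f1.
have [|L2 [leL2 _ _ f2]] := @short_locality _ C L1 _ locC; first lia.
have leU := (leq_card_setU L1 L2).1.
have [|L3 [leL3 _ _ f3]] := @short_locality _ C (L1 :|: L2) _ locC; first by lia.
by apply: gU; apply: leq_ltn_trans f3; lia.
Qed.

(** Two checks lift the potential to 7. If the union had size [u <= 5], the [7 - u] Griesmer terms
    would be [d], one term at least 2 as [d >= 3], and others at least 1, forcing [n >= d + 7]. *)
Lemma card_setU_parity_check (L1 L2 : {set 'I_n}) :
  (3 <= d)%N -> (n <= d + 6)%N -> (#|L1| <= 3)%N -> (#|L2| <= 3)%N ->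
  parity_check C L1 -> parity_check C L2 -> L1 != set0 -> ~~ (L2 \subset L1) ->
  #|L1 :|: L2| = 6%N.
Proof.
move=> d3 nd leL1 leL2 p1 p2 L1n0 L21.
have := @dim_short_parity_check _ C set0 L1 p1; rewrite subset0 => /(_ L1n0).
rewrite short0 dimC cards0 set0U => f1.
have f2 := dim_short_parity_check p2 L21.
have : (7 <= \dim (short C (L1 :|: L2)) + #|L1 :|: L2|)%N by lia.
move=> /short_length; have := (leq_card_setU L1 L2).1.
move: #|_ :|: _| => u leu; have {leu}: (u <= 6)%N by lia.
case: u => [|[|[|[|[|[|[|//]]]]]]] _ //=; lia.
Qed.

Lemma length_gt_d6 : (3 <= d)%N -> (d + 6 < n)%N.
Proof.
move=> d3; rewrite ltnNge; apply/negP=> nd.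
have [|L1 [leL1 p1]] := @short_locality _ C set0 _ locC; first by rewrite short0 dimC.
rewrite short0 dimC cards0 set0U subset0 => L1n0 f1.
have [|L2 [leL2 p2 L21 f2]] := @short_locality _ C L1 _ locC; first lia.
have c12 := card_setU_parity_check d3 nd leL1 leL2 p1 p2 L1n0 L21.
have /short_neq0[x [i [sx iU xi]]] : (0 < \dim (short C (L1 :|: L2)))%N by lia.
have [L3 [iL3 leL3 p3]] := locality_parity_check i locC.
have L2n0 : L2 != set0 by apply: contraNneq L21 => ->; rewrite sub0set.
have c13 : #|L1 :|: L3| = 6%N.
  apply: card_setU_parity_check => //; apply/subsetPn; exists i => //.
  by apply: contra iU; rewrite inE => ->.
have c23 : #|L2 :|: L3| = 6%N.
  apply: card_setU_parity_check => //; apply/subsetPn; exists i => //.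
  by apply: contra iU; rewrite inE => ->; rewrite orbT.
have d13 : [disjoint L1 & L3].
  rewrite -setI_eq0 -cards_eq0; have := cardsUI L1 L3; lia.
have d23 : [disjoint L2 & L3].
  rewrite -setI_eq0 -cards_eq0; have := cardsUI L2 L3; lia.
(* [x] has weight at least [d], and at most [d] coordinates lie outside the six of [L1 :|: L2]. *)
have suppx : supp x = ~: (L1 :|: L2).
  apply/eqP; rewrite eqEcard; move: sx; rewrite mem_short => /andP[Cx xU].
  rewrite -disjoints_subset xU /=.
  have wx : (d <= wt x)%N.
    by apply: dC => //; apply: contraNneq xi => ->; rewrite mxE.
  by apply: leq_trans wx; rewrite cardsCs setCK card_ord c12 leq_subLR addnC.
have := p3 x; have /shortP[-> _] := sx => /(_ isT)/eqP; apply/negP.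
(* [x] is constantly 1 on [L3], and three ones do not sum to 0. *)
rewrite (eq_bigr (fun=> 1)) => [|j jL3].
  rewrite sumr_const; suff -> : #|L3| = 3%N by [].
  by have := (leq_card_setU L1 L3).1; lia.
apply/eqP; rewrite -F2_neq0.
have: j \in supp x by rewrite suppx !inE (disjointFl d13 jL3) (disjointFl d23 jL3).
by rewrite inE.
Qed.

End Length.

(** * Codes given by a list of columns, with computable tests *)

(* Points of F_2^k are encoded as natural numbers by their binary digits. *)
Definition bit v k := odd (iter k half v).

Fixpoint dot (m : seq bool) v : bool :=
  if m is b :: m' then (b && odd v) (+) dot m' v./2 else false.

Fixpoint bitseqs k : seq (seq bool) :=
  if k is k'.+1 then [seq b :: m | b <- [:: false; true], m <- bitseqs k']
  else [:: [::]].

(** [m] is a message, nonzero when [has id m], and [count (dot m) s] is the weight of its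
    codeword. *)
Definition wt_check k d (s : seq nat) :=
  all (fun m => has id m ==> (d <= count (dot m) s)%N) (bitseqs k).

(** Two sufficient reasons for recovery: a repeated column, or a sum of two columns whose values
    differ from [v], hence whose positions do too. *)
Definition local_col k (s : seq nat) v :=
  (1 < count_mem v s)%N ||
  has (fun a => has (fun b => [&& a != v, b != v &
    all (fun i => bit v i == bit a i (+) bit b i) (iota 0 k)]) s) s.

Definition local_check k (s : seq nat) := all (local_col k s) s.

Lemma mem_bitseqs m : m \in bitseqs (size m).
Proof.
elim: m => // b m IHm; rewrite /= cats0 mem_cat.
by case: b; rewrite map_f ?orbT.
Qed.

Lemma F2_natr_addb (a b : bool) : (a (+) b)%:R = a%:R + b%:R :> 'F_2.
Proof. by apply/eqP; case: a; case: b. Qed.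

Lemma dot_sum k m v : size m = k ->
  (dot m v)%:R = \sum_(a < k) (nth false m a)%:R * (bit v a)%:R :> 'F_2.
Proof.
move=> <-; elim: m v => [|b m IHm] v /=; first by rewrite big_ord0.
rewrite big_ord_recl F2_natr_addb IHm -natrM mulnb; congr (_ + _).
by apply: eq_bigr => a _; rewrite /bit /= -iterSr.
Qed.

Lemma card_nth_count (p : pred nat) (s : seq nat) :
  #|[set i : 'I_(size s) | p (nth 0%N s i)]| = count p s.
Proof.
rewrite -sum1_count (big_nth 0%N) big_mkord -sum1_card.
by apply: eq_bigl => i; rewrite inE.
Qed.

Section ColumnCode.

Variables (k : nat) (s : seq nat).

Definition gen_mx : 'M['F_2]_(k, size s) :=
  \matrix_(a, i) (bit (nth 0%N s i) a)%:R.

Definition column_code : {vspace 'rV['F_2]_(size s)} :=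
  limg (linfun (mulmxr gen_mx)).

Lemma column_codeP x :
  reflect (exists u, x = u *m gen_mx) (x \in column_code).
Proof.
apply: (iffP memv_imgP) => [[u _ ->]|[u ->]]; exists u; rewrite ?memvf //.
  by rewrite lfunE.
by rewrite lfunE.
Qed.

Lemma gen_mxE (u : 'rV_k) i :
  (u *m gen_mx) 0 i = \sum_a u 0 a * (bit (nth 0%N s i) a)%:R.
Proof. by rewrite mxE; apply: eq_bigr => a _; rewrite mxE. Qed.

Lemma wt_gen_mx d (u : 'rV_k) :
  wt_check k d s -> u != 0 -> (d <= wt (u *m gen_mx))%N.
Proof.
move=> /allP chk u0; pose m := [tuple u 0 a != 0 | a < k].
have nthm (a : 'I_k) : nth false m a = (u 0 a != 0).
  by rewrite -tnth_nth tnth_mktuple.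
have hasm : has id m.
  apply/negPn/negP => /hasPn m0; case/eqP: u0; apply/rowP => a.
  rewrite mxE; apply/eqP; rewrite -[_ == _]negbK; apply: m0.
  by rewrite -nthm mem_nth // size_tuple.
have := mem_bitseqs m; rewrite size_tuple => /chk; rewrite hasm /= => led.
apply: leq_trans led _; rewrite -card_nth_count /wt; apply: eq_leq.
apply: eq_card => i; rewrite !inE gen_mxE.
rewrite (eq_bigr (fun a : 'I_k => (nth false m a)%:R * (bit (nth 0%N s i) a)%:R)).
  by rewrite -dot_sum ?size_tuple //; case: (dot _ _).
by move=> a _; rewrite nthm -F2_boolE.
Qed.

Lemma column_code_is_code d :
  (0 < d)%N -> wt_check k d s -> is_code k d column_code.
Proof.
move=> d0 chk; split; last first.
  apply/min_dist_ge_wt => x /column_codeP[u ->] x0; apply: wt_gen_mx => //.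
  by apply: contraNneq x0 => ->; rewrite mul0mx.
(* As [d > 0], nonzero messages have nonzero codewords, so encoding is injective and preserves
   dimension. *)
rewrite limg_dim_eq ?dimvf /dim /= ?mul1n //.
apply/eqP; rewrite -subv0; apply/subvP=> u; rewrite memv_cap memv_ker lfunE /=.
rewrite memv0 => /andP[_]; apply: contraLR => u0.
have := wt_gen_mx chk u0; apply: contraTneq => ->.
by rewrite -ltnNge wt0.
Qed.

Lemma column_code_local : local_check k s -> has_locality column_code 2.
Proof.
move=> /allP chk i; set v := nth 0%N s i.
have /chk/orP[cv|] : v \in s by rewrite mem_nth.
  move: cv; rewrite -(card_nth_count (pred1 v)) (cardsD1 i) !inE /= eqxx add1n ltnS.
  rewrite card_gt0 => /set0Pn[j]; rewrite !inE => /andP[ji /eqP vj].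
  exists [set j]; split; rewrite ?inE 1?eq_sym ?cards1 //.
  move=> _ _ /column_codeP[u ->] /column_codeP[w ->] /(_ j).
  by rewrite inE eqxx !gen_mxE vj -/v => ->.
case/hasP=> a sa /hasP[b sb /and3P[av bv /allP vab]].
have ia : (index a s < size s)%N by rewrite index_mem.
have ib : (index b s < size s)%N by rewrite index_mem.
pose ja := Ordinal ia; pose jb := Ordinal ib.
have na : nth 0%N s ja = a by rewrite nth_index.
have nb : nth 0%N s jb = b by rewrite nth_index.
exists [set ja; jb]; split.
- rewrite !inE negb_or; apply/andP; split.
    by apply: contraNneq av => ij; rewrite -na -ij.
  by apply: contraNneq bv => ij; rewrite -nb -ij.
- by rewrite cards2; case: (_ != _).
have sumE (u : 'rV_k) : (u *m gen_mx) 0 i = (u *m gen_mx) 0 ja + (u *m gen_mx) 0 jb.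
  rewrite !gen_mxE -/v na nb -big_split /=; apply: eq_bigr => c _.
  have /vab/eqP-> : nat_of_ord c \in iota 0 k by rewrite mem_iota /=.
  by rewrite F2_natr_addb mulrDr.
move=> _ _ /column_codeP[u ->] /column_codeP[w ->] uw.
by rewrite !sumE !uw // !inE eqxx ?orbT.
Qed.

End ColumnCode.

(** * Combining column lists and adding simplex codes *)

Lemma is_lrc_length_check k d s n :
  size s = n -> (0 < d)%N -> wt_check k d s -> local_check k s ->
  is_lrc_length 'F_2 k d 2 n.
Proof.
move=> <- d0 wts locs; exists (column_code k s).
by split; [apply: column_code_is_code | apply: column_code_local].
Qed.

Lemma wt_check_cat k d1 d2 s1 s2 :
  wt_check k d1 s1 -> wt_check k d2 s2 -> wt_check k (d1 + d2) (s1 ++ s2).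
Proof.
move=> /allP w1 /allP w2; apply/allP=> m km; apply/implyP=> m0.
rewrite count_cat leq_add //.
  by have /implyP := w1 _ km; apply.
by have /implyP := w2 _ km; apply.
Qed.

Lemma local_col_subseq k s t v : subseq s t -> local_col k s v -> local_col k t v.
Proof.
move=> st /orP[cv|/hasP[a sa /hasP[b sb ab]]].
  by rewrite /local_col (leq_trans cv) // leq_count_subseq.
apply/orP; right; apply/hasP; exists a; first exact: mem_subseq sa.
by apply/hasP; exists b; first exact: mem_subseq sb.
Qed.

Lemma local_check_cat k s1 s2 :
  local_check k s1 -> local_check k s2 -> local_check k (s1 ++ s2).
Proof.
move=> l1 l2; rewrite /local_check all_cat; apply/andP; split.
  by apply: sub_all l1 => v; apply/local_col_subseq/prefix_subseq.
by apply: sub_all l2 => v; apply/local_col_subseq/suffix_subseq.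
Qed.

Local Close Scope ring_scope.

(** [iota 1 31] lists the nonzero points of F_2^5, the columns of the simplex code, whose nonzero
    words all have weight 16. *)
Definition simplex5_copies t := flatten (nseq t (iota 1 31)).

Lemma simplex5_copiesP t :
  [/\ size (simplex5_copies t) = (31 * t)%N,
      wt_check 5 (16 * t) (simplex5_copies t) &
      local_check 5 (simplex5_copies t)].
Proof.
have w1 : wt_check 5 16 (iota 1 31) by vm_compute.
have l1 : local_check 5 (iota 1 31) by vm_compute.
elim: t => [|t [szt wt lt]]; first by split; vm_compute.
have -> : simplex5_copies t.+1 = iota 1 31 ++ simplex5_copies t by [].
split; last exact: local_check_cat.
- by rewrite size_cat szt mulnS.
- by rewrite mulnS; apply: wt_check_cat.
Qed.

(** For i < 5, 2^i divides 16 t, so each ceiling shifts exactly, and 16 + 8 + 4 + 2 + 1 = 31. *)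
Lemma griesmer5D16 d t : (griesmer 5 (d + 16 * t) = griesmer 5 d + 31 * t)%N.
Proof. rewrite /=; lia. Qed.

Lemma min_lrc_length_griesmer t d s n :
  (0 < d)%N -> size s = n -> n = griesmer 5 d ->
  wt_check 5 d s -> local_check 5 s ->
  min_lrc_length 'F_2 5 (d + 16 * t) 2 (n + 31 * t).
Proof.
move=> d0 szs gn ws ls; have [szt wt lt] := simplex5_copiesP t; split.
  apply: (@is_lrc_length_check _ _ (s ++ simplex5_copies t)).
  - by rewrite size_cat szs szt.
  - by rewrite addn_gt0 d0.
  - exact: wt_check_cat.
  - exact: local_check_cat.
move=> m [C [[dimC /min_dist_ge_wt dC] _]].
by have := length_dim5 dimC dC; rewrite griesmer5D16 -gn.
Qed.

Lemma min_lrc_length_small d s n :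
  (0 < d)%N -> size s = n -> wt_check 5 d s -> local_check 5 s ->
  (forall m (C : {vspace 'rV['F_2]_m}),
     \dim C = 5%N -> min_wt_ge C d -> has_locality C 2 -> (n <= m)%N) ->
  min_lrc_length 'F_2 5 d 2 n.
Proof.
move=> d0 szs ws ls lower; split; first exact: is_lrc_length_check ws ls.
by move=> m [C [[dimC /min_dist_ge_wt dC] locC]]; apply: lower locC.
Qed.

(** * Explicit point multisets and the exact values *)

(* The multisets of points of PG(4,2) with Griesmer parameters for even d: the
   complements of the empty set, of the line {1,2,3}, of the plane {1..7}, and
   of that plane together with the disjoint line {8,16,24}. Adding the affine
   space {16..31} raises d by 8, and deleting a point gives d - 1. *)
Definition belov16 := iota 1 31.
Definition belov14 := iota 4 28.
Definition belov12 := iota 8 24.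
Definition belov10 := [seq v <- iota 8 24 | v \notin [:: 8; 16; 24]%N].

Definition affine := iota 16 16.

Theorem theorem29 :
  (forall t : nat,
     min_lrc_length 'F_2 5 (9 + 16 * t) 2 (20 + 31 * t) /\
     min_lrc_length 'F_2 5 (10 + 16 * t) 2 (21 + 31 * t) /\
     min_lrc_length 'F_2 5 (11 + 16 * t) 2 (23 + 31 * t) /\
     min_lrc_length 'F_2 5 (12 + 16 * t) 2 (24 + 31 * t) /\
     min_lrc_length 'F_2 5 (13 + 16 * t) 2 (27 + 31 * t) /\
     min_lrc_length 'F_2 5 (14 + 16 * t) 2 (28 + 31 * t) /\
     min_lrc_length 'F_2 5 (15 + 16 * t) 2 (30 + 31 * t) /\
     min_lrc_length 'F_2 5 (16 + 16 * t) 2 (31 + 31 * t) /\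
     min_lrc_length 'F_2 5 (17 + 16 * t) 2 (36 + 31 * t) /\
     min_lrc_length 'F_2 5 (18 + 16 * t) 2 (37 + 31 * t) /\
     min_lrc_length 'F_2 5 (19 + 16 * t) 2 (39 + 31 * t) /\
     min_lrc_length 'F_2 5 (20 + 16 * t) 2 (40 + 31 * t) /\
     min_lrc_length 'F_2 5 (21 + 16 * t) 2 (43 + 31 * t) /\
     min_lrc_length 'F_2 5 (22 + 16 * t) 2 (44 + 31 * t) /\
     min_lrc_length 'F_2 5 (23 + 16 * t) 2 (46 + 31 * t) /\
     min_lrc_length 'F_2 5 (24 + 16 * t) 2 (47 + 31 * t)) /\
  min_lrc_length 'F_2 5 1 2 8 /\
  min_lrc_length 'F_2 5 2 2 8 /\
  min_lrc_length 'F_2 5 3 2 10 /\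
  min_lrc_length 'F_2 5 4 2 11 /\
  min_lrc_length 'F_2 5 5 2 13 /\
  min_lrc_length 'F_2 5 6 2 14 /\
  min_lrc_length 'F_2 5 7 2 16 /\
  min_lrc_length 'F_2 5 8 2 17.
Proof.
split=> [t|].
  repeat match goal with |- _ /\ _ => split end.
  - refine (@min_lrc_length_griesmer t 9 (behead belov10) 20 _ _ _ _ _); by vm_compute.
  - refine (@min_lrc_length_griesmer t 10 belov10 21 _ _ _ _ _); by vm_compute.
  - refine (@min_lrc_length_griesmer t 11 (behead belov12) 23 _ _ _ _ _); by vm_compute.
  - refine (@min_lrc_length_griesmer t 12 belov12 24 _ _ _ _ _); by vm_compute.
  - refine (@min_lrc_length_griesmer t 13 (behead belov14) 27 _ _ _ _ _); by vm_compute.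
  - refine (@min_lrc_length_griesmer t 14 belov14 28 _ _ _ _ _); by vm_compute.
  - refine (@min_lrc_length_griesmer t 15 (behead belov16) 30 _ _ _ _ _); by vm_compute.
  - refine (@min_lrc_length_griesmer t 16 belov16 31 _ _ _ _ _); by vm_compute.
  - refine (@min_lrc_length_griesmer t 17 (behead (belov10 ++ affine)) 36 _ _ _ _ _); by vm_compute.
  - refine (@min_lrc_length_griesmer t 18 (belov10 ++ affine) 37 _ _ _ _ _); by vm_compute.
  - refine (@min_lrc_length_griesmer t 19 (behead (belov12 ++ affine)) 39 _ _ _ _ _); by vm_compute.
  - refine (@min_lrc_length_griesmer t 20 (belov12 ++ affine) 40 _ _ _ _ _); by vm_compute.
  - refine (@min_lrc_length_griesmer t 21 (behead (belov14 ++ affine)) 43 _ _ _ _ _); by vm_compute.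
  - refine (@min_lrc_length_griesmer t 22 (belov14 ++ affine) 44 _ _ _ _ _); by vm_compute.
  - refine (@min_lrc_length_griesmer t 23 (behead (belov16 ++ affine)) 46 _ _ _ _ _); by vm_compute.
  - refine (@min_lrc_length_griesmer t 24 (belov16 ++ affine) 47 _ _ _ _ _); by vm_compute.
repeat match goal with |- _ /\ _ => split end.
(* The lines {1,2,3} and {4,8,12} and the doubled point 16: a direct sum of two [3,2,2] codes and a
   [2,1,2] code, serving both [d = 1] and [d = 2]. *)
- refine (@min_lrc_length_small 1
    [:: 1; 2; 3; 4; 8; 12; 16; 16] 8 _ _ _ _ _).
  1-4: by vm_compute.
  by move=> m C dimC dC locC; apply: (length_ge8 dimC dC locC).
- refine (@min_lrc_length_small 2
    [:: 1; 2; 3; 4; 8; 12; 16; 16] 8 _ _ _ _ _).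
  1-4: by vm_compute.
  by move=> m C dimC dC locC; apply: (length_ge8 dimC dC locC).
- refine (@min_lrc_length_small 3
    [:: 4; 5; 12; 15; 17; 20; 21; 23; 24; 26] 10 _ _ _ _ _).
  1-4: by vm_compute.
  by move=> m C dimC dC locC; apply: (length_gt_d6 dimC dC locC).
- refine (@min_lrc_length_small 4
    [:: 3; 8; 11; 16; 17; 19; 21; 23; 25; 28; 30] 11 _ _ _ _ _).
  1-4: by vm_compute.
  by move=> m C dimC dC locC; apply: (length_gt_d6 dimC dC locC).
- refine (@min_lrc_length_small 5
    [:: 2; 3; 4; 5; 6; 8; 10; 13; 17; 22; 24; 26; 27] 13 _ _ _ _ _).
  1-4: by vm_compute.
  (* Check sizes 1, 2 and 3 all give the same bound 13; they also coincide for [d] = 6, 7 and 8. *)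
  by move=> m C dimC dC locC; have [[|[|[|[]]]]] := length_parity_check1 dimC dC locC.
- refine (@min_lrc_length_small 6
    [:: 1; 2; 10; 11; 12; 14; 17; 19; 21; 22; 24; 27; 28; 30] 14 _ _ _ _ _).
  1-4: by vm_compute.
  by move=> m C dimC dC locC; have [[|[|[|[]]]]] := length_parity_check1 dimC dC locC.
- refine (@min_lrc_length_small 7
    [:: 1; 2; 4; 5; 6; 9; 10; 15; 16; 21; 22; 23; 24; 27; 27; 28] 16 _ _ _ _ _).
  1-4: by vm_compute.
  by move=> m C dimC dC locC; have [[|[|[|[]]]]] := length_parity_check1 dimC dC locC.
(* [affine] alone gives the first-order Reed-Muller code of length 16; the point 1 forms a line with
   each [v] and its translate by 1, which supplies the locality. *)
- refine (@min_lrc_length_small 8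
    (1%N :: affine) 17 _ _ _ _ _).
  1-4: by vm_compute.
  by move=> m C dimC dC locC; have [[|[|[|[]]]]] := length_parity_check1 dimC dC locC.
Qed.
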